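(* Let $A\geq a\geq 1$ be integers, and let $Omes_{1,A,a}$ be the set of overpartitions $\pi$ such that all parts of $\pi$ of size $\equiv a\pmod A$ and less than $mes_{1,A,a}(\pi)$ are overlined. Then \[ \sum_{\pi\in Omes_{1,A,a}}z^{mes_{1,A,a}(\pi)}q^{|\pi|} =\frac{(-q;q)_{\infty}}{(q;q)_{\infty}}\sum_{k=0}^{\infty}z^{kA+a}\bigg[q^{A\binom{k}{2}+ka} \frac{(q^a;q^A)_k}{(-q^a;q^A)_k}-2q^{A\binom{k+1}{2}+(k+1)a} \frac{(q^a;q^A)_k}{(-q^a;q^A)_{k+1}}\bigg]. \]
   Context: An overpartition is a partition (finite non-increasing sequence of positive integers) in which the first occurrence of each part value may be overlined; $|\pi|$ is the sum of parts. A part is of size $t$ if it equals $t$ or $\overline{t}$. $(a;q)_\infty=\prod_{i\geq0}(1-aq^i)$, $(a;q)_n=(a;q)_\infty/(aq^n;q)_\infty$; $|q|<1$, $z$ a formal variable. $mes_{1,A,a}(\pi)$ is the smallest positive integer $\equiv a\pmod A$ such that no part of $\pi$ has that size. *)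

(* Defs.v *)
From HB Require Import structures.
From mathcomp Require Import all_boot all_order all_algebra.
From mathcomp Require Import finmap complex zify.
From mathcomp Require Import all_classical all_reals all_analysis summability.

Set Implicit Arguments.
Unset Strict Implicit.
Unset Printing Implicit Defensive.

Import Order.TTheory GRing.Theory Num.Theory.
Import numFieldNormedType.Exports.

Local Open Scope classical_set_scope.

(* A part is a pair (t, b): it has size t and is overlined iff b = true. *)
Definition part : Type := (nat * bool)%type.
Definition psize (p : part) : nat := p.1.
Definition overlined (p : part) : bool := p.2.

Definition is_overpartition (s : seq part) : bool :=
  [&& all (fun p => 0 < psize p) s,
      sorted geq (map psize s)
    & [forall i : 'I_(size s),
         overlined (nth (0, false) s i) ==>
         (psize (nth (0, false) s i) \notin map psize (take i s))]].

Record overpartition : Type := Overpartition {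
  parts :> seq part;
  partsP : is_overpartition parts }.

HB.instance Definition _ := [isSub for parts].
HB.instance Definition _ := [Countable of overpartition by <:].

Definition weight (pi : overpartition) : nat := sumn (map psize pi).

Definition missing (A a : nat) (pi : overpartition) (m : nat) : Prop :=
  [/\ 0 < m, m = a %[mod A] & forall p, p \in parts pi -> psize p <> m].

(* The default value 0 is only taken when no candidate exists, which does not
   happen for 0 < A (lemma mesP). *)
Definition mes (A a : nat) (pi : overpartition) : nat :=
  xget 0 [set m | missing A a pi m /\ forall m', missing A a pi m' -> m <= m'].

Lemma mesP (A a : nat) (pi : overpartition) : 0 < A ->
  missing A a pi (mes A a pi) /\
  forall m, missing A a pi m -> mes A a pi <= m.
Proof.
move=> A0; rewrite /mes; case: xgetP => [m _ []//|noP]; exfalso.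
have ex : exists m, `[< missing A a pi m >].
  exists (a + (weight pi).+1 * A); apply/asboolP; split.
  - by rewrite addn_gt0 muln_gt0 A0 orbT.
  - by rewrite addnC modnMDl.
  - move=> p ppi; suff : psize p <= weight pi by nia.
    rewrite /weight; elim: (parts pi) ppi => //= x s IH.
    rewrite inE => /orP[/eqP->|/IH]; first exact: leq_addr.
    by move/leq_trans; apply; exact: leq_addl.
have [m /asboolP Pm mmin] := ex_minnP ex.
by apply: (noP m); split=> // m' Pm'; apply: mmin; apply/asboolP.
Qed.

(* An overlined part is a first occurrence, so a part size that satisfies the
   condition below occurs exactly once. *)
Definition Omes (A a : nat) : set overpartition :=
  [set pi | forall p, p \in parts pi ->
      psize p = a %[mod A] -> psize p < mes A a pi -> overlined p].

Local Open Scope ring_scope.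

Definition qpoch_inf (K : numFieldType) (x q : K) : K :=
  lim ((\prod_(0 <= i < n) (1 - x * q ^+ i)) @[n --> \oo]).

Definition qpoch (K : numFieldType) (x q : K) (n : nat) : K :=
  qpoch_inf x q / qpoch_inf (x * q ^+ n) q.

(* Formal power series in z over K, given by their coefficients and with
   coefficientwise convergence. *)
Definition fps (K : Type) : Type := nat -> K.

(* c z^m *)
Definition fps_monom (K : numFieldType) (c : K) (m : nat) : fps K :=
  fun n => if n == m then c else 0.

Definition fps_scale (K : numFieldType) (c : K) (f : fps K) : fps K :=
  fun n => c * f n.

Definition fps_series (K : numFieldType) (u : nat -> fps K) : fps K :=
  fun n => lim ((\sum_(0 <= k < N) u k n) @[N --> \oo]).

(* \sum_(i in D) f i = g, the sum being unordered (totally is the filter of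
   finite subsets of I ordered by inclusion) *)
Definition fps_has_sum (K : numFieldType) (I : choiceType) (D : set I)
    (f : I -> fps K) (g : fps K) : Prop :=
  forall n, (\sum_(i <- F | i \in D) f i n) @[F --> totally] --> g n.

(* Main.v *)
Require Import Defs.
From HB Require Import structures.
From mathcomp Require Import all_boot all_order all_algebra.
From mathcomp Require Import finmap complex zify ring lra.
From mathcomp Require Import all_classical all_reals all_analysis summability.
Set Implicit Arguments.
Unset Strict Implicit.
Unset Printing Implicit Defensive.
Import Order.TTheory GRing.Theory Num.Theory.
Import numFieldNormedType.Exports.
Local Open Scope classical_set_scope.

(* An overpartition is determined by the numbers of plain and overlined parts
   of each size t, and it lies in Omes with mes = kA+a iff every size jA+a with
   j < k occurs exactly once, overlined, and the size kA+a does not occur, the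
   other sizes being free.  Hence the coefficient of z^(kA+a) is
     (-q;q)_oo / (q;q)_oo * \prod_(j < k) q^(jA+a)
       * \prod_(j <= k) (1 - q^(jA+a)) / (1 + q^(jA+a)),
   which equals the bracket of the theorem because
   (1 + w) - 2 w = 1 - w for w = q^(kA+a).

   To make this an unordered sum, exhaust the index set by the overpartitions
   with part sizes and plain multiplicities at most N: their generating
   function is a finite product, which converges at q to the coefficient above
   and converges at |q|, whence absolute summability. *)

(** * Overpartitions and multiplicities *)

(* Not reflexive at overlined parts: pairwise part_succ forces an overlined part
   to be the first of its size. *)
Definition part_succ : rel part :=
  fun p p' => (p'.1 < p.1)%N || ((p'.1 == p.1) && ~~ p'.2).

Lemma part_succ_trans : transitive part_succ.
Proof. by move=> [t b] [u c] [v d]; rewrite /part_succ /=; lia. Qed.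

Lemma part_succ_anti : antisymmetric part_succ.
Proof.
move=> [t b] [u c]; rewrite /part_succ /= => h.
have -> : t = u by lia.
by congr pair; case: b c h => [] [] //=; lia.
Qed.

(** Putting [x] in front of [s] adds one predecessor to every later position, so by induction the
    positional clause on overlined parts becomes a condition on pairs. *)
Lemma is_overpartitionE (s : seq part) :
  is_overpartition s = all (fun p => 0 < psize p)%N s && pairwise part_succ s.
Proof.
rewrite /is_overpartition; congr andb.
have geq_trans : transitive geq by move=> x y z /= h1 h2; exact: leq_trans h2 h1.
rewrite (sorted_pairwise geq_trans) pairwise_map.
elim: s => [|x s IHs] /=; first by apply/forallP => -[].
rewrite -IHs; apply/andP/andP => [[/andP[/allP gx srt] /forallP ov]|].
  split.
    apply/allP => p ps; have := gx p ps; rewrite /part_succ /psize /= leq_eqVlt.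
    move=> /orP[/eqP e|->//]; apply/orP; right; rewrite e eqxx /=; apply/negP => p2.
    have idx : (index p s).+1 < (size s).+1 by rewrite ltnS index_mem.
    have := ov (Ordinal idx); rewrite /= nth_index// /overlined p2 /= in_cons.
    by rewrite /psize e eqxx.
  rewrite srt; apply/forallP => i; have ltis : i.+1 < (size s).+1 by rewrite ltnS.
  have /implyP := ov (Ordinal ltis); rewrite /= in_cons negb_or => h.
  by apply/implyP => /h/andP[].
move=> [/allP sx /andP[srt /forallP ov]]; split.
  rewrite srt andbT; apply/allP => p /sx; rewrite /part_succ /psize /=; lia.
apply/forallP => -[[|i] ltis] /=; apply/implyP => hov //.
rewrite ltnS in ltis; have /implyP/(_ hov) := ov (Ordinal ltis).
rewrite in_cons negb_or => /= ->.
rewrite andbT; have := sx _ (mem_nth (0, false) ltis).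
move: hov; rewrite /part_succ /overlined /psize => -> /=; lia.
Qed.

(** [part_succ] is transitive and antisymmetric, so a list sorted by it is determined by its
    multiset. Equality can thus be checked by counting. *)
Lemma overpartition_eq (pi rho : overpartition) :
  perm_eq (parts pi) (parts rho) -> pi = rho.
Proof.
move=> h; apply/val_inj/(sorted_eq part_succ_trans part_succ_anti) => //.
all: rewrite (sorted_pairwise part_succ_trans).
all: have := partsP pi; have := partsP rho; rewrite !is_overpartitionE.
all: by move=> /andP[_ ?] /andP[_ ?].
Qed.

Lemma count_overlined (pi : overpartition) t :
  count_mem (t, true) (parts pi) = ((t, true) \in parts pi).
Proof.
have := partsP pi; rewrite is_overpartitionE => /andP[_].
elim: (parts pi) => //= x s IHs /andP[/allP sx /IHs ->]; rewrite in_cons [_ == x]eq_sym.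
case: eqVneq => //= e; case: (boolP (_ \in s)) => // /sx; rewrite e.
by rewrite /part_succ /= ltnn andbF.
Qed.

Definition mult (pi : overpartition) (t : nat) : nat * bool :=
  (count_mem (t, false) (parts pi), (t, true) \in parts pi).

Fixpoint parts_of_mult (m : nat -> nat * bool) (N : nat) : seq part :=
  if N is n.+1 then
    nseq (m N).2 (N, true) ++ nseq (m N).1 (N, false) ++ parts_of_mult m n
  else [::].

Lemma parts_of_mult_size m N p :
  p \in parts_of_mult m N -> (0 < psize p <= N)%N.
Proof.
elim: N => //= n IHn; rewrite !mem_cat !mem_nseq => /or3P[|| /IHn].
- by move=> /andP[_ /eqP ->]; rewrite /psize /= leqnn.
- by move=> /andP[_ /eqP ->]; rewrite /psize /= leqnn.
- by move=> /andP[-> /leqW ->].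
Qed.

Lemma count_parts_of_mult m N t b :
  count_mem (t, b) (parts_of_mult m N) =
  if (0 < t <= N)%N then (if b then nat_of_bool (m t).2 else (m t).1) else 0.
Proof.
elim: N => [|n IHn] /=; first by case: t.
rewrite !count_cat IHn !count_nseq /= !xpair_eqE.
case: (ltngtP t n.+1) => [ltn|gtn|->].
- by rewrite /= !mul0n !add0n; congr (if _ then _ else _); lia.
- by rewrite /= !mul0n !add0n ifF; [rewrite ifF //|]; lia.
- by rewrite /= ltnn {IHn}; case: b; rewrite /= ?mul0n ?mul1n ?addn0.
Qed.

Lemma parts_of_multP m N : is_overpartition (parts_of_mult m N).
Proof.
rewrite is_overpartitionE; apply/andP; split.
  by apply/allP => p /parts_of_mult_size /andP[].
elim: N => //= n IHn; rewrite !pairwise_cat IHn andbT.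
have blk b k : allrel part_succ (nseq k (n.+1, b)) (parts_of_mult m n).
  apply/allrelP => x y; rewrite mem_nseq => /andP[_ /eqP ->] /parts_of_mult_size.
  by rewrite /psize /part_succ /= => h; apply/orP; left; lia.
rewrite allrel_catr !blk /= !andbT; apply/and3P; split.
- apply/allrelP => x y; rewrite !mem_nseq => /andP[_ /eqP ->] /andP[_ /eqP ->].
  by rewrite /part_succ /= eqxx orbT.
- by case: (m _).2.
- elim: (m _).1 => //= k ->; rewrite andbT; apply/allP => x.
  by rewrite mem_nseq => /andP[_ /eqP ->]; rewrite /part_succ /= eqxx orbT.
Qed.

Definition of_mult (m : nat -> nat * bool) (N : nat) : overpartition :=
  Overpartition (parts_of_multP m N).

Lemma mult_of_mult m N t :
  mult (of_mult m N) t = if (0 < t <= N)%N then m t else (0, false).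
Proof.
rewrite /mult.
have ht := count_parts_of_mult m N t true.
have hf := count_parts_of_mult m N t false.
rewrite /of_mult /=.
rewrite hf.
have -> : (t, true) \in parts_of_mult m N = (count_mem (t, true) (parts_of_mult m N) != 0%N).
  by rewrite -lt0n -has_count has_pred1.
by rewrite ht; case: ifP => // _; case: (m t) => n [].
Qed.

Lemma psize_le_weight (pi : overpartition) p : p \in parts pi -> (psize p <= weight pi)%N.
Proof.
rewrite /weight; elim: (parts pi) => //= x s IH.
rewrite in_cons => /orP[/eqP->|/IH]; first exact: leq_addr.
by move/leq_trans; apply; exact: leq_addl.
Qed.

Lemma psize_gt0 (pi : overpartition) p : p \in parts pi -> (0 < psize p)%N.
Proof. by move=> h; have := partsP pi; case/and3P => /allP/(_ p h). Qed.

Lemma mult_le_weight (pi : overpartition) t : ((mult pi t).1 <= weight pi)%N.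
Proof.
apply: (@leq_trans (size pi)); first exact: count_size.
have := partsP pi; case/and3P => + _ _; rewrite /weight.
by elim: (parts pi) => //= x s IH /andP[x0 /IH]; lia.
Qed.

Lemma of_multK (pi : overpartition) N :
  (forall p, p \in parts pi -> (psize p <= N)%N) -> of_mult (mult pi) N = pi.
Proof.
move=> leN; apply: overpartition_eq; apply/allP => -[t b] _ /=; apply/eqP.
rewrite count_parts_of_mult; case: ifP => h.
  by case: b; rewrite /= ?count_overlined.
apply/esym/eqP; rewrite -leqn0 leqNgt -has_count has_pred1; apply/negP => tpi.
by have := leN _ tpi; have := psize_gt0 tpi; rewrite /psize /= in h *; lia.
Qed.

Lemma eq_of_mult m m' N : (forall t, (0 < t <= N)%N -> m t = m' t) ->
  of_mult m N = of_mult m' N.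
Proof.
move=> h; apply: overpartition_eq; apply/allP => -[t b] _ /=; apply/eqP.
by rewrite !count_parts_of_mult; case: ifP => // /h ->.
Qed.

Lemma weight_of_mult m N :
  weight (of_mult m N) = \sum_(i < N) i.+1 * ((m i.+1).1 + (m i.+1).2).
Proof.
rewrite /weight /=; elim: N => [|n IHn]; first by rewrite big_ord0.
by rewrite big_ord_recr /= !map_cat !sumn_cat !map_nseq IHn !sumn_nseq /psize /=; lia.
Qed.

(* f i describes the size i.+1; the value at t = 0 is junk. *)
Definition bounded_mult N (f : {ffun 'I_N -> 'I_N.+1 * bool}) (t : nat) : nat * bool :=
  if insub t.-1 is Some i then (nat_of_ord (f i).1, (f i).2) else (0, false).

Lemma bounded_multE N f (i : 'I_N) : bounded_mult f i.+1 = (nat_of_ord (f i).1, (f i).2).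
Proof. by rewrite /bounded_mult /= valK. Qed.

(** * Finite exhaustions by bounded sizes and multiplicities *)

Section BoundedOverpartitions.
Variables (Q : nat -> nat * bool -> bool) (N : nat).

(** [Q] constrains each size separately, which makes the generating function of this list factor
    over the sizes. *)
Definition bounded_overpartitions : seq overpartition :=
  [seq of_mult (bounded_mult f) N |
    f <- enum (family (fun i : 'I_N =>
      [pred j : 'I_N.+1 * bool | Q i.+1 (nat_of_ord j.1, j.2)]))].

Lemma bounded_overpartitions_uniq : uniq bounded_overpartitions.
Proof.
rewrite map_inj_uniq ?enum_uniq// => f g fg; apply/ffunP => i.
have := congr1 (fun pi => mult pi i.+1) fg.
rewrite !mult_of_mult ltn_ord /= !bounded_multE.
by case: (f i) (g i) => [x b] [y c] /= [/val_inj -> ->].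
Qed.

(** The weight bounds both the part sizes and the plain multiplicities. Hence every overpartition
    that satisfies [Q] enters the list once [N] reaches its weight. *)
Lemma mem_bounded_overpartitions (pi : overpartition) : (weight pi <= N)%N ->
  (forall t, (0 < t)%N -> Q t (mult pi t)) -> pi \in bounded_overpartitions.
Proof.
move=> wN Qpi.
pose f : {ffun 'I_N -> 'I_N.+1 * bool} :=
  [ffun i : 'I_N => (inord (mult pi i.+1).1, (mult pi i.+1).2)].
have fE (i : 'I_N) : (nat_of_ord (f i).1, (f i).2) = mult pi i.+1.
  rewrite /f ffunE inordK //.
  by rewrite ltnS; exact: leq_trans (mult_le_weight _ _) wN.
apply/mapP; exists f.
  by rewrite mem_enum; apply/familyP => i; rewrite inE fE Qpi.
rewrite -[LHS](@of_multK _ N); last by move=> p /psize_le_weight /leq_trans; apply.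
apply: eq_of_mult => -[//|t] /andP[_ tN].
by rewrite (bounded_multE f (Ordinal tN)) fE.
Qed.

(** Sizes above [N] do not occur in a listed overpartition, so there [Q] has to accept multiplicity
    zero. For [omes_mult] this is so as soon as [N] is at least [k * A + a]. *)
Lemma bounded_overpartitionsP (pi : overpartition) :
  (forall t, (N < t)%N -> Q t (0, false)) ->
  pi \in bounded_overpartitions -> forall t, (0 < t)%N -> Q t (mult pi t).
Proof.
move=> Q0 /mapP[f]; rewrite mem_enum => /familyP fQ -> t t0.
rewrite mult_of_mult t0 /=; case: leqP => [|/Q0//].
case: t t0 => // t _ tN; have := fQ (Ordinal tN); rewrite inE.
by rewrite (bounded_multE f (Ordinal tN)).
Qed.

Lemma sum_bounded_overpartitions (K : comNzRingType) (q : K) :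
  (\sum_(pi <- bounded_overpartitions) q ^+ weight pi =
  \prod_(i < N) \sum_(j : 'I_N.+1 * bool | Q i.+1 (nat_of_ord j.1, j.2))
    q ^+ (i.+1 * (j.1 + j.2)))%R.
Proof.
rewrite bigA_distr_big_dep big_map big_enum /=; apply: eq_bigr => f _.
rewrite weight_of_mult -prodrXr; apply: eq_bigr => i _.
by rewrite bounded_multE.
Qed.

End BoundedOverpartitions.

(** * Membership in [Omes] read off the multiplicities *)

Definition omes_mult (A a k t : nat) (m : nat * bool) : bool :=
  ((t == a %[mod A]) && (t <= k * A + a)) ==> (m == (0, t < k * A + a)).

Lemma mult_missingP (pi : overpartition) t :
  reflect (forall p, p \in parts pi -> psize p <> t) (mult pi t == (0, false)).
Proof.
rewrite /mult xpair_eqE -leqn0 leqNgt -has_count has_pred1 eqbF_neg.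
apply: (iffP andP) => [[hf ht] [u b] + /= ut|h].
  by rewrite ut; case: b => h; [move: ht|move: hf]; rewrite h.
by split; apply/negP => /h.
Qed.

Lemma modn_eq_progression (A a n : nat) : (0 < a <= A)%N -> (0 < n)%N ->
  n = a %[mod A] -> exists k, n = (k * A + a)%N.
Proof.
move=> aA n0 h; have an : (a <= n)%N.
  rewrite leqNgt; apply/negP => na; move: h; rewrite modn_small; last by lia.
  (* For [a = A] the residue is 0, not [a], hence the separate case. *)
  by have [->|aA'] := eqVneq a A; rewrite ?modnn ?modn_small; lia.
exists ((n - a) %/ A); move/eqP: h; rewrite eqn_mod_dvd// => /divnK ->.
by rewrite subnK.
Qed.

Lemma Omes_mesP (A a k : nat) (pi : overpartition) : (0 < a <= A)%N ->
  (Omes A a pi /\ mes A a pi = (k * A + a)%N) <->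
  (forall t, (0 < t)%N -> omes_mult A a k t (mult pi t)).
Proof.
move=> aA; have A0 : (0 < A)%N by lia.
have [[m0 ma mmis] mmin] := mesP a pi A0.
split=> [[Opi mk] t t0|h].
  apply/implyP => /andP[/eqP ta]; rewrite -mk leq_eqVlt => /orP[/eqP ->|tm].
    by rewrite ltnn; apply/mult_missingP.
  have tf : (t, false) \notin parts pi by apply/negP => /Opi /= /(_ ta tm).
  (* If the overlined part were absent too, [t] would be missing and smaller than [mes]. *)
  have tt : (t, true) \in parts pi.
    apply/negPn/negP => tt; have := mmin t; rewrite leqNgt tm => /(_ _)/notF; apply.
    split=> // -[u b] upi /= ut; move: upi; rewrite ut.
    by case: b; apply/negP.
  by rewrite /mult tm tt xpair_eqE eqxx andbT; apply/eqP/count_memPn.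
have hk : missing A a pi (k * A + a).
  split; [lia|by rewrite modnMDl|].
  apply/mult_missingP; have := h (k * A + a)%N; rewrite /omes_mult modnMDl eqxx leqnn ltnn /=.
  by apply; lia.
(* A smaller value of [mes] would be a constrained size, hence would occur overlined and not be
   missing. *)
have mk : mes A a pi = (k * A + a)%N.
  apply/eqP; rewrite eqn_leq (mmin _ hk) leqNgt; apply/negP => mlt.
  have := h _ m0; rewrite /omes_mult mlt (ltnW mlt) ma eqxx /= => /eqP e.
  have /mult_missingP := mmis; rewrite e //.
split=> // -[t b] tpi /= ta; rewrite mk => tk.
have := h t (psize_gt0 tpi); rewrite /omes_mult ta eqxx tk (ltnW tk) /= => /eqP[/count_memPn].
by case: b tpi => // ->.
Qed.

Local Open Scope ring_scope.
Local Open Scope complex_scope.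
Import Normc.

(** * Infinite products of complex numbers *)

(** The two limits have product 1. Applied to partial products, this shows that an infinite product
    is nonzero. *)
Lemma lim_inverse_neq0 (K : numFieldType) (f g : nat -> K) :
  (forall n, f n * g n = 1) -> cvgn f -> cvgn g -> lim (f @ \oo) != 0.
Proof.
move=> fg cf cg; have : f n * g n @[n --> \oo] --> lim (f @ \oo) * lim (g @ \oo).
  exact: cvgM.
under eq_cvg do rewrite fg.
move=> /(cvg_lim (@norm_hausdorff _ _)) h; apply: contraPneq h => ->.
by rewrite mul0r lim_cst//; apply/eqP; exact: oner_neq0.
Qed.

Lemma qpoch_infS (K : numFieldType) (x q : K) :
  (forall y : K, cvgn (fun n => \prod_(0 <= i < n) (1 - y * q ^+ i))) ->
  qpoch_inf x q = (1 - x) * qpoch_inf (x * q) q.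
Proof.
move=> cv; apply/cvg_lim; first exact: norm_hausdorff.
rewrite -(cvg_shiftS (fun n => \prod_(0 <= i < n) (1 - x * q ^+ i) : K^o)) /=.
under eq_cvg => n.
  rewrite big_nat_recl// expr0 mulr1.
  under eq_bigr do rewrite exprS mulrA.
  over.
by apply: cvgM => //; exact: cvg_cst.
Qed.

(** Convergence is assumed at every [y] because the induction moves the base point along
    [x * q ^+ m]. *)
Lemma qpoch_inf_split (K : numFieldType) (x q : K) m :
  (forall y : K, cvgn (fun n => \prod_(0 <= i < n) (1 - y * q ^+ i))) ->
  qpoch_inf x q = \prod_(0 <= i < m) (1 - x * q ^+ i) * qpoch_inf (x * q ^+ m) q.
Proof.
move=> cv; elim: m => [|m IHm]; first by rewrite big_geq// mul1r expr0 mulr1.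
by rewrite IHm qpoch_infS// big_nat_recr //= -!mulrA -exprSr.
Qed.

Lemma geometric_sum_le (R : realType) (C r : R) n : 0 <= C -> 0 <= r < 1 ->
  \sum_(0 <= i < n) C * r ^+ i <= C / (1 - r).
Proof.
move=> C0 /andP[r0 r1].
have -> : \sum_(0 <= i < n) C * r ^+ i = series (geometric C r) n by [].
rewrite geometric_seriesE ?lt_eqF//= ler_pM2r ?invr_gt0 ?subr_gt0//.
by rewrite ler_piMr// gerBl exprn_ge0.
Qed.

Section ComplexSequences.
Variable R : realType.
Local Notation C := (Num.NumField.sort (R[i] : numFieldType)).
Implicit Types (u : nat -> C) (l q x : C).

Lemma normr_normc z : `|z| = (normc z)%:C :> R[i].
Proof. by case: z. Qed.

Lemma normc_ge0 (z : R[i]) : 0 <= normc z.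
Proof. by rewrite -ler0c -normr_normc normr_ge0. Qed.

Lemma cvg_normc u l : normc (u n - l) @[n --> \oo] --> (0 : R) -> u @ \oo --> l.
Proof.
move=> /cvgrPdistC_le h; apply/cvgrPdistC_le => -[e e'].
(* A positive element of [R[i]] has zero imaginary part, so the radius is real. *)
rewrite ltcE /= => /andP[/eqP-> e0].
apply: filterS (h e e0) => n; rewrite subr0 ger0_norm ?normc_ge0// => hn.
by rewrite normr_normc lecR.
Qed.

Lemma normc_le_ReIm (z : R[i]) : normc z <= `|complex.Re z| + `|complex.Im z|.
Proof.
case: z => x y /=; rewrite -[leRHS]ger0_norm ?addr_ge0// -sqrtr_sqr ler_wsqrtr//.
rewrite sqrrD !real_normK ?num_real// -addrA lerD2l -[leLHS]add0r lerD2r.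
by rewrite mulrn_wge0// mulr_ge0.
Qed.

Lemma Re_le_normc (z : R[i]) : `|complex.Re z| <= normc z.
Proof. by rewrite -lecR -normr_normc normc_ge_Re. Qed.

Lemma Im_le_normc (z : R[i]) : `|complex.Im z| <= normc z.
Proof. by case: z => x y /=; rewrite -sqrtr_sqr ler_wsqrtr// lerDr sqr_ge0. Qed.

(** The real and imaginary parts of [u] telescope into real series dominated by [v], hence
    absolutely convergent. *)
Lemma normc_summable_cvg u (v : nat -> R) :
  (forall n, normc (u n.+1 - u n) <= v n) -> cvgn (series v) -> cvgn u.
Proof.
move=> uv cv.
have real_part (w : nat -> R) : (forall n, `|w n.+1 - w n| <= v n) -> cvgn w.
  move=> wv; have -> : w = (fun n => w 0%N + series (fun k => w k.+1 - w k) n).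
    by apply/funext => n; rewrite /series /= telescope_sumr// addrC subrK.
  apply: is_cvgD; first exact: is_cvg_cst.
  apply: normed_cvg; apply: series_le_cvg cv => n //=.
  exact: le_trans (wv n).
have cR : cvgn (fun n => complex.Re (u n)).
  by apply: real_part => n; rewrite -raddfB; apply: le_trans (uv n); exact: Re_le_normc.
have cI : cvgn (fun n => complex.Im (u n)).
  by apply: real_part => n; rewrite -raddfB; apply: le_trans (uv n); exact: Im_le_normc.
set a := lim _ in cR; set b := lim _ in cI.
apply/cvg_ex; exists (a +i* b); apply: cvg_normc.
apply: (@squeeze_cvgr _ _ _ _ (cst 0)
  (fun n => `|complex.Re (u n) - a| + `|complex.Im (u n) - b|)).
- near=> n; rewrite normc_ge0 /=; apply: le_trans (normc_le_ReIm _) _.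
  by case: (u n).
- exact: cvg_cst.
- rewrite -[X in _ --> X](addr0 (0 : R)); apply: cvgD.
  + rewrite -[X in _ --> X](normr0 R) -(subrr a); apply: cvg_norm.
    by apply: cvgB => //; exact: cvg_cst.
  + rewrite -[X in _ --> X](normr0 R) -(subrr b); apply: cvg_norm.
    by apply: cvgB => //; exact: cvg_cst.
Unshelve. all: by end_near. Qed.

Lemma normc_prod_le (I : Type) (s : seq I) (P : pred I) (u : I -> R[i]) :
  normc (\prod_(i <- s | P i) (1 + u i)) <= expR (\sum_(i <- s | P i) normc (u i)).
Proof.
elim/big_rec2: _ => [|i y z _ h]; first by rewrite normc1 expR0.
rewrite normcM expRD ler_pM ?normc_ge0//.
apply: le_trans (expR_ge1Dx _); apply: le_trans (le_normcD _ _) _.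
by rewrite normc1.
Qed.

Lemma normc_prodB1_le (I : Type) (s : seq I) (P : pred I) (u : I -> R[i]) :
  normc (\prod_(i <- s | P i) (1 + u i) - 1) <=
  expR (\sum_(i <- s | P i) normc (u i)) - 1.
Proof.
elim/big_rec2: _ => [|i y z _ h]; first by rewrite subrr normc0 expR0 subrr.
(* With n the modulus of [u i], the induction hypothesis bounds this by (1 + n)(exp y - 1) + n = (1
   + n) exp y - 1, which is at most exp (n + y) - 1. *)
have -> : (1 + u i) * z - 1 = (1 + u i) * (z - 1) + u i by ring.
apply: le_trans (le_normcD _ _) _; rewrite normcM.
have h1 : normc (1 + u i) <= 1 + normc (u i).
  by apply: le_trans (le_normcD _ _) _; rewrite normc1.
have h2 := expR_ge1Dx (normc (u i)).
have h3 := expR_gt0 y.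
have h4 := normc_ge0 (u i); have h5 := normc_ge0 (z - 1).
rewrite expRD; nra.
Qed.

(** All partial products are bounded by [B], the exponential of the full geometric sum, so their
    increments are at most [B * C * r ^+ n]. *)
Lemma prod1p_geometric_cvg u (C r : R) : 0 <= C -> 0 <= r < 1 ->
  (forall i, normc (u i) <= C * r ^+ i) ->
  cvgn (fun n => \prod_(0 <= i < n) (1 + u i)).
Proof.
move=> C0 /andP[r0 r1] ur.
have nr : `|r| < 1 by rewrite ger0_norm.
pose B := expR (C / (1 - r)).
apply: (@normc_summable_cvg _ (geometric (B * C) r)); last exact: is_cvg_geometric_series.
move=> n; rewrite big_nat_recr //= mulrDr mulr1 addrC addrA addNr add0r normcM -mulrA.
apply: ler_pM; rewrite ?normc_ge0//.
apply: le_trans (normc_prod_le _ _ _) _; rewrite ler_expR.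
apply: le_trans (geometric_sum_le _ C0 _); last by rewrite r0.
by apply: ler_sum => i _; exact: ur.
Qed.

Lemma normcX (z : R[i]) n : normc (z ^+ n) = normc z ^+ n.
Proof. by elim: n => [|n IHn]; rewrite ?expr0 ?normc1// !exprS normcM IHn. Qed.

Lemma is_cvg_qpoch_inf x q : `|q| < 1 ->
  cvgn (fun n => \prod_(0 <= i < n) (1 - x * q ^+ i)).
Proof.
move=> q1; apply: (@prod1p_geometric_cvg (fun i => - (x * q ^+ i)) (normc x) (normc q)).
- exact: normc_ge0.
- by rewrite normc_ge0 -ltcR -normr_normc.
- by move=> i; rewrite normcN normcM normcX.
Qed.

(* The product of the inverses 1 / (1 - x q^i) = 1 + v i converges as well. *)
Lemma qpoch_inf_neq0 x q : `|q| < 1 -> `|x| < 1 -> qpoch_inf x q != 0.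
Proof.
move=> q1 x1; have nq1 : normc q < 1 by rewrite -ltcR -normr_normc.
have nx1 : normc x < 1 by rewrite -ltcR -normr_normc.
pose v i : C := x * q ^+ i / (1 - x * q ^+ i).
have lb i : 1 - normc x <= normc (1 - x * q ^+ i).
  have := le_normcD (1 - x * q ^+ i) (x * q ^+ i); rewrite subrK normc1 normcM normcX.
  have : normc x * normc q ^+ i <= normc x.
    by rewrite ler_piMr ?normc_ge0// exprn_ile1 ?normc_ge0// ltW.
  lra.
have nz i : 1 - x * q ^+ i != 0.
  by apply: contraTneq (lb i) => ->; rewrite normc0 -ltNge subr_gt0.
have cv : cvgn (fun n => \prod_(0 <= i < n) (1 + v i)).
  (* The denominator of [v i] is at least [1 - normc x] in modulus, by [lb]. *)
  apply: (@prod1p_geometric_cvg v (normc x / (1 - normc x)) (normc q)).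
  - by rewrite divr_ge0 ?normc_ge0// subr_ge0 ltW.
  - by rewrite normc_ge0.
  - move=> i; rewrite /v !normcM normcV normcX mulrAC ler_wpM2r ?exprn_ge0 ?normc_ge0//.
    rewrite ler_wpM2l ?normc_ge0// lef_pV2 ?lb// posrE ?subr_gt0//.
    by apply: lt_le_trans (lb i); rewrite subr_gt0.
apply: lim_inverse_neq0 cv => [n|]; last exact: is_cvg_qpoch_inf.
rewrite -big_split big1 //= => i _.
by rewrite /v mulrDr mulr1 mulrCA divff // mulr1 subrK.
Qed.

(** The tail product starts at [x * q ^+ n], still of modulus below 1, so it is nonzero and
    cancels. *)
Lemma qpochE x q n : `|q| < 1 -> `|x| < 1 ->
  qpoch x q n = \prod_(0 <= i < n) (1 - x * q ^+ i).
Proof.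
move=> q1 x1.
have xqn m : `|x * q ^+ m| < 1.
  by apply: le_lt_trans x1; rewrite normrM normrX ler_piMr// exprn_ile1// ltW.
rewrite /qpoch (@qpoch_inf_split _ x q n) ?mulfK ?qpoch_inf_neq0//.
by move=> y; exact: is_cvg_qpoch_inf.
Qed.

(** These factors are the error made by cutting the geometric series of plain multiplicities at [N];
    [P] will select the unconstrained sizes. *)
Lemma cvg_truncation_factor (q : C) (P : pred nat) : `|q| < 1 ->
  \prod_(i < N | P i) (1 - q ^+ (i.+1 * N.+1)) @[N --> \oo] --> (1 : C).
Proof.
move=> q1; pose r := normc q.
have r0 : 0 <= r := normc_ge0 q.
have r1 : r < 1 by rewrite -ltcR -normr_normc.
apply: cvg_normc.
apply: (@squeeze_cvgr _ _ _ _ (cst 0) (fun N => expR (r ^+ N / (1 - r)) - 1)).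
- near=> N; rewrite normc_ge0 /=.
  apply: le_trans (normc_prodB1_le _ _ _) _; rewrite lerB// ler_expR.
  apply: le_trans (@geometric_sum_le _ (r ^+ N) r N _ _); rewrite ?exprn_ge0 ?r0//.
  rewrite big_mkord [leLHS]big_mkcond; apply: ler_sum => i _.
  case: ifP => _; last by rewrite mulr_ge0 ?exprn_ge0.
  (* The exponent satisfies (i+1)(N+1) >= N + i, which leaves a geometric sum with the small
     constant [r ^+ N]. *)
  rewrite normcN normcX -exprD ler_wiXn2l// ?r0 ?ltW//; nia.
- exact: cvg_cst.
- rewrite -[X in _ --> X](subrr (1 : R)); apply: cvgB; last exact: cvg_cst.
  rewrite -(expR0 R); apply: continuous_cvg; first exact: continuous_expR.
  under eq_cvg do rewrite mulrC.
  by apply: cvg_geometric; rewrite ger0_norm.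
Unshelve. all: by end_near. Qed.

End ComplexSequences.

(** * Unordered sums *)

Lemma big_sub_seq (K : zmodType) (I : eqType) (s1 s2 : seq I) (f : I -> K) :
  uniq s1 -> uniq s2 -> {subset s1 <= s2} ->
  \sum_(i <- s2) f i = \sum_(i <- s1) f i + \sum_(i <- s2 | i \notin s1) f i.
Proof.
move=> u1 u2 s12; rewrite (bigID (mem s1)) /=; congr (_ + _).
rewrite -big_filter; apply: perm_big; apply: uniq_perm => //; first exact: filter_uniq.
by move=> i; rewrite mem_filter andb_idr//; exact: s12.
Qed.

(** Take [N0] beyond which the sums of [f] and of its norms are close to their limits. A finite set
    containing [S N0] adds terms of [D] that all lie in some later [S M], and their norms sum to at
    most a difference of two absolute sums. [S] need not be monotone: [S N0] lies in [S M] by way of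
    [G]. *)
Lemma cvg_totally_exhaustion (K : numFieldType) (I : choiceType) (D : set I)
    (f : I -> K) (S : nat -> seq I) (l : K) :
  (forall N, uniq (S N)) ->
  (\forall N \near \oo, forall i, i \in S N -> D i) ->
  (forall i, D i -> \forall N \near \oo, i \in S N) ->
  \sum_(i <- S N) f i @[N --> \oo] --> l ->
  cvgn (fun N => \sum_(i <- S N) `|f i|) ->
  (fun F : {fset I} => \sum_(i <- F | i \in D) f i) @ totally --> l.
Proof.
move=> uS SD DS fl /cvg_ex[L /= fL].
have totallyF : Filter (@totally I) := totally_filter.
apply/cvgrPdist_le => e e0.
have e2 : 0 < e / 2 by rewrite divr_gt0.
have e4 : 0 < e / 4 by rewrite divr_gt0.
have [N0 _ hN0] : \forall N \near \oo, [/\ (forall i, i \in S N -> D i),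
    `|l - \sum_(i <- S N) f i| <= e / 2 & `|L - \sum_(i <- S N) `|f i| | <= e / 4].
  move/cvgrPdist_le : fl => /(_ _ e2) fl; move/cvgrPdist_le : fL => /(_ _ e4) fL.
  by near=> N; split; near: N.
have [SD0 l0 L0] := hN0 N0 (leqnn _).
exists [fset i in S N0]%fset => //= F /fsubsetP SF.
pose G := [seq i <- F | i \in D].
have uG : uniq G by rewrite filter_uniq.
have SG : {subset S N0 <= G}.
  move=> i iS; rewrite mem_filter SF ?inE// andbT; apply/mem_set; exact: SD0.
have [M /= GM NM] : exists2 M, {subset G <= S M} & (N0 <= M)%N.
  have : \forall M \near \oo, forall i, i \in (F : seq I) -> i \in D -> i \in S M.
    elim: (F : seq I) => [|x s IHs]; first by near=> M.
    have xS : \forall M \near \oo, x \in D -> x \in S M.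
      have [/set_mem/DS xD|xD] := boolP (x \in D); last by near=> M.
      by near=> M => _; near: M.
    near=> M => i; rewrite in_cons => /orP[/eqP ->|]; first by near: M.
    by move: i; near: M.
  move=> [M _ hM]; exists (maxn M N0); last exact: leq_maxr.
  by move=> i; rewrite mem_filter => /andP[iD iF]; exact: hM (leq_maxl _ _) _ _ _.
have [SDM lM LM] := hN0 M NM.
rewrite -big_filter -/G (big_sub_seq f (uS N0) uG SG) opprD addrA.
apply: le_trans (ler_normB _ _) _; rewrite [leRHS]splitr lerD//.
apply: (@le_trans _ _ (\sum_(i <- S M | i \notin S N0) `|f i|)).
  apply: le_trans (ler_norm_sum _ _ _) _; rewrite big_mkcond [leRHS]big_mkcond /=.
  rewrite (big_sub_seq _ uG (uS M) GM) lerDl sumr_ge0// => i _.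
  by case: ifP.
rewrite -[leLHS]ger0_norm ?sumr_ge0//.
have -> : \sum_(i <- S M | i \notin S N0) `|f i| =
    (L - \sum_(i <- S N0) `|f i|) - (L - \sum_(i <- S M) `|f i|).
  rewrite (big_sub_seq _ (uS N0) (uS M)); last by move=> i /SG /GM.
  by rewrite opprB addrC addrA subrK addrC addKr.
have -> : e / 2 = e / 4 + e / 4 by field.
by apply: le_trans (ler_normB _ _) _; exact: lerD.
Unshelve. all: by end_near. Qed.

(** * The generating function *)

Definition in_mes_progression (A a k t : nat) : bool :=
  (t == a %[mod A])%N && (t <= k * A + a)%N.

(** The bound on [N] ensures that all [k.+1] constrained sizes lie in the range of the left
    product. *)
Lemma big_mes_progression (K : comNzRingType) (A a k N : nat) (G : nat -> K) :
  (0 < a <= A)%N -> (k * A + a <= N)%N ->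
  \prod_(i < N | in_mes_progression A a k i.+1) G i.+1 =
  \prod_(j < k.+1) G (j * A + a)%N.
Proof.
move=> aA kN; rewrite -(big_mkord xpredT (fun j => G (j * A + a)%N)).
rewrite -(big_mkord (fun i => in_mes_progression A a k i.+1) (fun i => G i.+1)).
rewrite -(big_add1 _ _ 0 N.+1 (in_mes_progression A a k) G).
rewrite -big_filter -(big_map (fun j => (j * A + a)%N) xpredT G).
apply: perm_big; apply: uniq_perm; first by rewrite filter_uniq ?iota_uniq.
  by rewrite map_inj_uniq ?iota_uniq// => i j; nia.
move=> t; rewrite mem_filter mem_index_iota; apply/andP/mapP => [[/andP[/eqP ta tk] t0]|].
  have [|j tj] := modn_eq_progression aA _ ta; first by lia.
  by exists j; rewrite // mem_index_iota; nia.
move=> [j]; rewrite mem_index_iota => jk ->; split; last by nia.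
by rewrite /in_mes_progression modnMDl eqxx /=; nia.
Qed.

(** A constrained size leaves a single term. For a free size the overlined choice gives
    [1 + q ^+ t], and the plain multiplicities give a finite geometric series. *)
Lemma sum_omes_mult (K : fieldType) (q : K) (A a k N t : nat) :
  1 - q ^+ t != 0 ->
  \sum_(j : 'I_N.+1 * bool | omes_mult A a k t (nat_of_ord j.1, j.2))
    q ^+ (t * (j.1 + j.2)) =
  if in_mes_progression A a k t then q ^+ (t * (t < k * A + a)%N)
  else (1 + q ^+ t) * (1 - q ^+ (t * N.+1)) / (1 - q ^+ t).
Proof.
move=> qt; rewrite /omes_mult -/(in_mes_progression A a k t).
case: ifP => _ /=.
  by rewrite (big_pred1 (ord0, (t < k * A + a)%N)) ?add0n.
rewrite -(pair_big xpredT xpredT (fun (j : 'I_N.+1) (b : bool) => q ^+ (t * (j + b)))) /=.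
apply: (mulIf qt); rewrite divfK //.
have -> : 1 - q ^+ (t * N.+1) = (1 - q ^+ t) * \sum_(j < N.+1) (q ^+ t) ^+ j.
  by rewrite exprM -[LHS]opprB subrX1 -mulNr opprB.
rewrite mulrCA mulrC; congr (_ * _); rewrite mulr_sumr; apply: eq_bigr => j _.
by rewrite big_bool /= !mulnDr muln1 muln0 addn0 exprD -exprM mulrDl mul1r addrC [in RHS]mulrC.
Qed.

(** The first quotient gives every size its free factor; the last product removes it again at the
    constrained sizes. *)
Lemma sum_bounded_omes (K : fieldType) (q : K) (A a k N : nat) :
  (forall t, (0 < t)%N -> 1 - q ^+ t != 0) ->
  (forall t, (0 < t)%N -> 1 + q ^+ t != 0) ->
  (0 < a <= A)%N -> (k * A + a <= N)%N ->
  \sum_(pi <- bounded_overpartitions (omes_mult A a k) N) q ^+ weight pi =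
  \prod_(i < N) (1 + q ^+ i.+1) / \prod_(i < N) (1 - q ^+ i.+1)
  * \prod_(i < N | ~~ in_mes_progression A a k i.+1) (1 - q ^+ (i.+1 * N.+1))
  * (\prod_(j < k) q ^+ (j * A + a)
     * \prod_(j < k.+1) ((1 - q ^+ (j * A + a)) / (1 + q ^+ (j * A + a)))).
Proof.
move=> qm qp aA kN; rewrite sum_bounded_overpartitions.
under eq_bigr => i _ do rewrite sum_omes_mult ?qm//.
(* The index [j = k] is added with exponent 0, so that this product too runs over all constrained
   sizes. *)
have -> : \prod_(j < k) q ^+ (j * A + a) =
    \prod_(j < k.+1) q ^+ ((j * A + a) * (j * A + a < k * A + a)%N).
  rewrite big_ord_recr /= ltnn muln0 expr0 mulr1; apply: eq_bigr => j _.
  by rewrite (_ : (_ < _)%N = true) ?muln1//; have := ltn_ord j; nia.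
rewrite -(big_mes_progression (fun t => q ^+ (t * (t < k * A + a)%N)) aA kN).
rewrite -(big_mes_progression (fun t => (1 - q ^+ t) / (1 + q ^+ t)) aA kN).
rewrite -prodf_div -big_split /= (bigID (fun i : 'I_N => in_mes_progression A a k i.+1)) /=.
rewrite [in RHS](bigID (fun i : 'I_N => in_mes_progression A a k i.+1) predT) /=.
rewrite -[X in _ = X * _]mulrA [RHS]mulrAC -!big_split /=; congr (_ * _); apply: eq_bigr => i.
  by move=> ->; have := qm i.+1 isT; have := qp i.+1 isT => h1 h2; field; rewrite h1 h2.
by move=> /negbTE ->; rewrite mulrAC.
Qed.

(** The analytic facts enter as hypotheses, so the passage to the limit, factor by factor, works
    over any [numFieldType]. *)
Lemma cvg_sum_bounded_omes_of (K : numFieldType) (q : K) (A a k : nat) :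
  `|q| < 1 -> (0 < a <= A)%N ->
  (forall x : K, cvgn (fun n => \prod_(0 <= i < n) (1 - x * q ^+ i))) ->
  qpoch_inf q q != 0 ->
  (forall P : pred nat,
    \prod_(i < N | P i) (1 - q ^+ (i.+1 * N.+1)) @[N --> \oo] --> (1 : K)) ->
  \sum_(pi <- bounded_overpartitions (omes_mult A a k) N) q ^+ weight pi
    @[N --> \oo] -->
  qpoch_inf (- q) q / qpoch_inf q q *
  (\prod_(j < k) q ^+ (j * A + a)
   * \prod_(j < k.+1) ((1 - q ^+ (j * A + a)) / (1 + q ^+ (j * A + a)))).
Proof.
move=> q1 aA cv qinf0 trunc.
have qt t : (0 < t)%N -> `|q ^+ t| < 1.
  by move=> t0; rewrite normrX exprn_ilt1 -?lt0n.
have qm t : (0 < t)%N -> 1 - q ^+ t != 0.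
  by move=> /qt h; rewrite subr_eq0; apply: contraTneq h => <-; rewrite normr1 ltxx.
have qp t : (0 < t)%N -> 1 + q ^+ t != 0.
  move=> /qt h; rewrite addrC addr_eq0; apply: contraTneq h => ->.
  by rewrite normrN1 ltxx.
have cvq x : \prod_(i < N) (1 - x * q ^+ i) @[N --> \oo] --> qpoch_inf x q.
  by under eq_cvg do rewrite -(big_mkord xpredT (fun i => 1 - x * q ^+ i)); exact: cv.
set T := (X in _ * X).
have : \prod_(i < N) (1 - - q * q ^+ i) / \prod_(i < N) (1 - q * q ^+ i)
    * \prod_(i < N | ~~ in_mes_progression A a k i.+1) (1 - q ^+ (i.+1 * N.+1))
    * T @[N --> \oo] --> qpoch_inf (- q) q / qpoch_inf q q * 1 * T.
  apply: cvgM; last exact: cvg_cst.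
  apply: cvgM; last exact: (trunc (fun i => ~~ in_mes_progression A a k i.+1)).
  by apply: cvgM => //; exact: cvgV.
(* The closed form is available only from [N = k * A + a] on. *)
rewrite mulr1; apply: cvg_trans; apply: near_eq_cvg; exists (k * A + a)%N => // N /= kN.
rewrite (sum_bounded_omes qm qp aA kN); congr (_ / _ * _ * _); apply: eq_bigr => i _.
  by rewrite mulNr opprK exprS.
by rewrite exprS.
Qed.

Lemma prod_mes_progression (K : fieldType) (q : K) (A a k : nat) :
  \prod_(j < k) q ^+ (j * A + a) = q ^+ (A * 'C(k, 2) + k * a).
Proof.
rewrite prodrXr; congr (_ ^+ _); elim: k => [|k IHk]; first by rewrite big_ord0 muln0.
by rewrite big_ord_recr /= IHk binS bin1; nia.
Qed.

Lemma omes_coef (K : fieldType) (q : K) (A a k : nat) :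
  (forall j, 1 + q ^+ (j * A + a) != 0) ->
  q ^+ (A * 'C(k, 2) + k * a)
    * (\prod_(0 <= i < k) (1 - q ^+ a * (q ^+ A) ^+ i)
       / \prod_(0 <= i < k) (1 - - q ^+ a * (q ^+ A) ^+ i))
  - 2 * q ^+ (A * 'C(k.+1, 2) + k.+1 * a)
    * (\prod_(0 <= i < k) (1 - q ^+ a * (q ^+ A) ^+ i)
       / \prod_(0 <= i < k.+1) (1 - - q ^+ a * (q ^+ A) ^+ i)) =
  \prod_(j < k) q ^+ (j * A + a)
  * \prod_(j < k.+1) ((1 - q ^+ (j * A + a)) / (1 + q ^+ (j * A + a))).
Proof.
move=> qp; rewrite -!prod_mes_progression.
have E j : q ^+ a * (q ^+ A) ^+ j = q ^+ (j * A + a).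
  by rewrite -exprM -exprD addnC mulnC.
have -> : \prod_(0 <= i < k) (1 - q ^+ a * (q ^+ A) ^+ i) = \prod_(j < k) (1 - q ^+ (j * A + a)).
  by rewrite big_mkord; apply: eq_bigr => j _; rewrite E.
have Em m : \prod_(0 <= i < m) (1 - - q ^+ a * (q ^+ A) ^+ i) = \prod_(j < m) (1 + q ^+ (j * A + a)).
  by rewrite big_mkord; apply: eq_bigr => j _; rewrite mulNr opprK E.
rewrite !Em !big_ord_recr /= prodf_div.
have := qp k; have : \prod_(j < k) (1 + q ^+ (j * A + a)) != 0 by apply/prodf_neq0.
(* With w = q^(kA+a) what remains is WX/Y - 2WwX/(Y(1+w)) = WX(1-w)/(Y(1+w)). *)
set W := \prod_(j < k) q ^+ _; set X := \prod_(j < k) (1 - _); set Y := \prod_(j < k) (1 + _).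
by move=> Y0 w0; field; rewrite Y0 w0.
Qed.

(** For positive [A] the exponents are distinct, so the partial sums at this coefficient are
    constant from [k.+1] on. *)
Lemma fps_series_monomE (K : numFieldType) (c : nat -> K) (A a k : nat) :
  (0 < A)%N -> fps_series (fun k => fps_monom (c k) (k * A + a)) (k * A + a) = c k.
Proof.
move=> A0; apply/cvg_lim; first exact: norm_hausdorff.
apply: cvg_near_cst; exists k.+1 => // N /= kN; apply/eqP.
rewrite big_mkord (bigD1 (Ordinal kN)) //= /fps_monom eqxx big1 ?addr0// => i ik.
by rewrite eqn_add2r eqn_pmul2r// ifN// eq_sym; apply: contraNneq ik => ki; apply/eqP/val_inj.
Qed.

Lemma fps_series_monom_eq0 (K : numFieldType) (c : nat -> K) (A a n : nat) :
  (forall k, n <> (k * A + a)%N) ->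
  fps_series (fun k => fps_monom (c k) (k * A + a)) n = 0.
Proof.
move=> nk; apply/cvg_lim; first exact: norm_hausdorff.
apply: cvg_near_cst; exists 0%N => // N _; apply/eqP; rewrite big1// => k _.
by rewrite /fps_monom; case: eqP => // /nk.
Qed.

Lemma fps_has_sum_Omes (K : numFieldType) (q : K) (A a : nat) (p : K) (c : nat -> K) :
  (0 < a <= A)%N ->
  (forall k, \sum_(pi <- bounded_overpartitions (omes_mult A a k) N) q ^+ weight pi
    @[N --> \oo] --> p * c k) ->
  (forall k, cvgn (fun N => \sum_(pi <- bounded_overpartitions (omes_mult A a k) N)
    `|q| ^+ weight pi)) ->
  fps_has_sum (Omes A a) (fun pi => fps_monom (q ^+ weight pi) (mes A a pi))
    (fps_scale p (fps_series (fun k => fps_monom (c k) (k * A + a)))).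
Proof.
move=> aA cq cr n; have A0 : (0 < A)%N by lia.
have totallyF : Filter (@totally overpartition) := totally_filter.
suff : (fun F : {fset overpartition} => \sum_(pi <- F | pi \in Omes A a)
      fps_monom (q ^+ weight pi) (mes A a pi) n) @ totally -->
    p * fps_series (fun k => fps_monom (c k) (k * A + a)) n by [].
have [[k nk]|nk] := pselect (exists k, n = (k * A + a)%N); last first.
  (* Outside the progression both sides vanish, since [mes] is positive and congruent to [a]. *)
  rewrite fps_series_monom_eq0; last by move=> k nE; apply: nk; exists k.
  rewrite mulr0 (_ : (fun F : {fset _} => _) = cst 0); first exact: cvg_cst.
  apply/funext => F; rewrite big1// => pi _; rewrite /fps_monom; case: eqP => // nE.
  have [[m0 ma _] _] := mesP a pi A0; case: nk; rewrite nE; exact: modn_eq_progression.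
rewrite nk fps_series_monomE//.
pose D : set overpartition := [set pi | Omes A a pi /\ mes A a pi = (k * A + a)%N].
rewrite (_ : (fun F : {fset _} => _) =
    (fun F : {fset _} => \sum_(pi <- F | pi \in D) q ^+ weight pi)); last first.
  apply/funext => F; rewrite /fps_monom -big_mkcondr; apply: eq_bigl => pi.
  by apply/andP/idP => [[/set_mem Opi /eqP h]|/set_mem[Opi h]];
    [apply/mem_set|split; [apply/mem_set|rewrite h]].
apply: (@cvg_totally_exhaustion K overpartition D (fun pi => q ^+ weight pi)
  (bounded_overpartitions (omes_mult A a k))).
- by move=> N; exact: bounded_overpartitions_uniq.
- exists (k * A + a)%N => // N /= kN pi piN; apply/(Omes_mesP k pi aA).
  apply: bounded_overpartitionsP piN => t Nt; rewrite /omes_mult implybE.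
  by rewrite [(t <= _)%N]leqNgt (leq_ltn_trans kN Nt) andbF.
- move=> pi /(Omes_mesP k pi aA) Qpi; exists (weight pi) => // N /= wN.
  exact: mem_bounded_overpartitions.
- exact: cq.
- rewrite (_ : (fun N => _) = (fun N =>
    \sum_(pi <- bounded_overpartitions (omes_mult A a k) N) `|q| ^+ weight pi)) //.
  by apply/funext => N; apply: eq_bigr => pi _; rewrite normrX.
Qed.

(** * Specialisation to the complex numbers *)

Section Complex.
Variable R : realType.
Local Notation C := (Num.NumField.sort (R[i] : numFieldType)).

Lemma cvg_sum_bounded_omes (q : C) (A a k : nat) : `|q| < 1 -> (0 < a <= A)%N ->
  \sum_(pi <- bounded_overpartitions (omes_mult A a k) N) q ^+ weight pi
    @[N --> \oo] -->
  qpoch_inf (- q) q / qpoch_inf q q *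
  (\prod_(j < k) q ^+ (j * A + a)
   * \prod_(j < k.+1) ((1 - q ^+ (j * A + a)) / (1 + q ^+ (j * A + a)))).
Proof.
move=> q1 aA; apply: cvg_sum_bounded_omes_of => //.
- by move=> x; exact: is_cvg_qpoch_inf.
- exact: qpoch_inf_neq0.
- by move=> P; exact: cvg_truncation_factor.
Qed.

Lemma qpoch_omes_coef (q : C) (A a k : nat) : `|q| < 1 -> (0 < a <= A)%N ->
  q ^+ (A * 'C(k, 2) + k * a)
    * (qpoch (q ^+ a) (q ^+ A) k / qpoch (- q ^+ a) (q ^+ A) k)
  - 2 * q ^+ (A * 'C(k.+1, 2) + k.+1 * a)
    * (qpoch (q ^+ a) (q ^+ A) k / qpoch (- q ^+ a) (q ^+ A) k.+1) =
  \prod_(j < k) q ^+ (j * A + a)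
  * \prod_(j < k.+1) ((1 - q ^+ (j * A + a)) / (1 + q ^+ (j * A + a))).
Proof.
move=> q1 aA.
have qt t : (0 < t)%N -> `|q ^+ t| < 1.
  by move=> t0; rewrite normrX exprn_ilt1 -?lt0n.
have qa : `|q ^+ a| < 1 by apply: qt; lia.
have qA : `|q ^+ A| < 1 by apply: qt; lia.
rewrite !qpochE ?normrN//; apply: omes_coef => j.
have /qt h : (0 < j * A + a)%N by lia.
by rewrite addrC addr_eq0; apply: contraTneq h => ->; rewrite normrN1 ltxx.
Qed.

End Complex.

Unset Implicit Arguments.

Theorem theorem2p4 (R : realType) (A a : nat) (q : R[i]) :
  (1 <= a <= A)%N -> `|q| < 1 ->
  fps_has_sum (Omes A a)
    (fun pi => fps_monom (q ^+ weight pi) (mes A a pi))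
    (fps_scale (qpoch_inf (- q) q / qpoch_inf q q)
      (fps_series (fun k : nat =>
        fps_monom
          (q ^+ (A * 'C(k, 2) + k * a)
             * (qpoch (q ^+ a) (q ^+ A) k / qpoch (- q ^+ a) (q ^+ A) k)
           - 2 * q ^+ (A * 'C(k.+1, 2) + k.+1 * a)
             * (qpoch (q ^+ a) (q ^+ A) k / qpoch (- q ^+ a) (q ^+ A) k.+1))
          (k * A + a)))).
Proof.
move=> aA q1; apply: fps_has_sum_Omes => // k.
  by rewrite qpoch_omes_coef//; exact: cvg_sum_bounded_omes.
(* Absolute convergence is the same limit statement taken at the norm of [q], viewed as an element
   of [R[i]]. *)
apply/cvg_ex; eexists; apply: cvg_sum_bounded_omes aA; rewrite ?normr_id//.
Qed.
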